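(* The class of static games is closed under the toggling disjunction, toggling conjunction, sequential disjunction and sequential conjunction operations, both in their $n$-ary versions ($n\ge2$) and their infinite versions. That is, if $A_1,A_2,\dots$ are static games, then $A_1\curlyvee\dots\curlyvee A_n$, $A_1\curlywedge\dots\curlywedge A_n$, $A_1\triangledown\dots\triangledown A_n$, $A_1\vartriangle\dots\vartriangle A_n$, $A_1\curlyvee A_2\curlyvee\dots$, $A_1\curlywedge A_2\curlywedge\dots$, $A_1\triangledown A_2\triangledown\dots$ and $A_1\vartriangle A_2\vartriangle\dots$ are static games.
   Context: Players are $\top$ and $\bot$; for a player $\wp$, $\neg\wp$ denotes the other player. A move is a string; a labeled move is $\wp\alpha$; a run is a finite or infinite sequence of labeled moves; a position is a finite run. A constant game $A$ consists of a set of legal positions (a run is a legal run iff all its finite initial segments are legal positions) and an assignment of a winner to each legal run. A run that is not legal is $\wp$-illegal if its shortest illegal initial segment ends with a $\wp$-labeled move; a $\wp$-illegal run is lost by $\wp$. A (general) game is a function from valuations $e$ (assignments of constants to variables) to constant games $e[A]$; operations on games are defined pointwise: $e[\mathrm{Op}(A_1,\dots)]=\mathrm{Op}(e[A_1],\dots)$. For a run $\Gamma$ and string $\alpha$, $\Gamma^{\alpha}$ is the result of deleting from $\Gamma$ all labeled moves except those of the form $\wp\alpha\beta$, and replacing each such $\wp\alpha\beta$ by $\wp\beta$. A run $\Omega$ is a $\wp$-delay of a run $\Gamma$ iff (1) for each player, the subsequence of that player's labeled moves in $\Omega$ equals that in $\Gamma$, and (2) for all $n,k\ge1$, if the $n$-th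 $\wp$-labeled move appears after the $k$-th $\neg\wp$-labeled move in $\Gamma$, then it does so in $\Omega$ too. A constant game $A$ is static iff for every player $\wp$ and runs $\Gamma,\Omega$ with $\Omega$ a $\wp$-delay of $\Gamma$: if $\Gamma$ is a $\wp$-won run of $A$ then so is $\Omega$. A game is static iff $e[A]$ is static for every valuation $e$. Let $A_1,\dots,A_n$ ($n\ge2$) be constant games. A switch move is a move (string) $i$ with $i\in\{1,\dots,n\}$. In a run with finitely many switch moves, the active component is $A_i$ where $i$ is the last switch move, or $A_1$ if there are none. Toggling disjunction $A_1\curlyvee\dots\curlyvee A_n$: a position $\Phi$ is legal iff every move of $\Phi$ is either a switch made by $\top$ or a move $i.\alpha$ ($i\in\{1,\dots,n\}$) by either player, and for each $i$, $\Phi^{i.}$ is a legal position of $A_i$. A legal run $\Gamma$ is $\top$-won iff it contains finitely many switches and, with $A_i$ the active component, $\Gamma^{i.}$ is a $\top$-won run of $A_i$. Toggling conjunction $A_1\curlywedge\dots\curlywedge A_n$: the same with switches made by $\bot$ instead of $\top$, and a legal run is $\bot$-won iff it contains finitely many switches and $\Gamma^{i.}$ is a $\bot$-won run of the active component $A_i$. Sequential disjunction $A_1\triangledown\dots\triangledown A_n$ (resp. conjunction $A_1\vartriangle\dots\vartriangle A_n$): defined exactly as $A_1\curlyvee\dots\curlyvee A_n$ (resp. $A_1\curlywedge\dots\curlywedge A_n$), with the additional legality condition on a position $\Phi$ that the sequence $i_1,\dots,i_j$ of switch moves in $\Phi$ satisfies $i_1=2,i_2=3,\dots,i_j=j+1$.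 The infinite versions $A_1\curlyvee A_2\curlyvee\dots$, etc., are defined identically with $i$ ranging over $\{1,2,\dots\}$.
   Formalization: Constant games are additionally required to have, in every legal position and for each player, at least one illegal move (a weak form of the usual never-legal move convention); without this, closure of static games under the toggling disjunction fails. *)

(* Defs.v *)
From mathcomp Require Import all_boot.
From mathcomp Require Import boolp classical_sets.
From Stdlib Require Ascii String DecimalString.

Set Implicit Arguments.
Unset Strict Implicit.
Unset Printing Implicit Defensive.

Local Open Scope nat_scope.

Inductive fiseq (T : Type) : Type :=
| Fin of seq T
| Inf of (nat -> T).

Definition item (T : Type) (G : fiseq T) (i : nat) : option T :=
  match G with Fin s => onth s i | Inf f => Some (f i) end.

Definition upto (T : Type) (n : nat) (G : fiseq T) : seq T :=
  match G with Fin s => take n s | Inf f => mkseq f n end.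

Definition initial (T : Type) (s : seq T) (G : fiseq T) : Prop :=
  exists n, s = upto n G.

(* The subsequence of the items at which g is defined, mapped through g.  For
   an infinite f its n-th item is the n-th item of [pmap g (mkseq f N)] for
   every sufficiently large N; if some n-th item does not exist, then g is
   undefined from some index on, and the subsequence is finite. *)
Definition pmap_fi (T U : Type) (g : T -> option U) (G : fiseq T) : fiseq U :=
  match G with
  | Fin s => Fin (pmap g s)
  | Inf f =>
      match pselect (forall n, exists u, exists N,
                       onth (pmap g (mkseq f N)) n = Some u) with
      | left H => Inf (fun n => projT1 (cid (H n)))
      | right _ =>
          Fin (pmap g (mkseq f
            (xget 0 [set N | forall k, N <= k -> g (f k) = None]%classic)))
      end
  end.

(* The adversary of p is ~~ p. *)
Definition player : Type := bool.
Definition Top : player := true.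
Definition Bot : player := false.

Definition move : Type := String.string.
Definition labmove : Type := (player * move)%type.
Definition position : Type := seq labmove.
Definition run : Type := fiseq labmove.

Fixpoint strip (a m : String.string) : option String.string :=
  match a, m with
  | String.EmptyString, _ => Some m
  | String.String c a', String.String d m' =>
      if Ascii.eqb c d then strip a' m' else None
  | String.String _ _, String.EmptyString => None
  end.

Definition strip_lab (a : String.string) (m : labmove) : option labmove :=
  omap (pair m.1) (strip a m.2).

(* Gamma^alpha *)
Definition proj (a : String.string) (G : run) : run := pmap_fi (strip_lab a) G.

Definition moves_of (p : player) (G : run) : run :=
  pmap_fi (fun m : labmove => if m.1 == p then Some m else None) G.

(* The n-th p-labeled move of G (counting from 1) is item i of G. *)
Definition nth_at (p : player) (n : nat) (G : run) (i : nat) : Prop :=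
  (exists a, item G i = Some (p, a)) /\
  count (fun m : labmove => m.1 == p) (upto i.+1 G) = n.

Definition appears_after (p : player) (n k : nat) (G : run) : Prop :=
  exists i j, [/\ nth_at p n G i, nth_at (~~ p) k G j & j < i].

Definition delay (p : player) (O G : run) : Prop :=
  (forall q : player, moves_of q O = moves_of q G) /\
  (forall n k, 1 <= n -> 1 <= k ->
     appears_after p n k G -> appears_after p n k O).

(* [legal_nil] and [legal_prefix] express that a position is a legal position
   iff it is a legal run, and that every illegal run is illegal by one of the
   players.  [illegal_move] is a weak form of the convention of computability
   logic that a distinguished move never occurs in a legal run; closure of the
   static games under the operations below fails without it.  [winner] is
   irrelevant on illegal runs. *)
Record cgame : Type := CGame {
  legal : position -> Prop;
  winner : run -> player;
  legal_nil : legal [::];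
  legal_prefix : forall s t, legal (s ++ t) -> legal s;
  illegal_move : forall s (p : player), legal s ->
    exists a : move, ~ legal (rcons s (p, a))
}.

Definition legal_run (A : cgame) (G : run) : Prop :=
  forall s, initial s G -> legal A s.

Definition illegal_by (A : cgame) (p : player) (G : run) : Prop :=
  exists s a,
    [/\ initial (rcons s (p, a)) G, ~ legal A (rcons s (p, a)) &
        forall t, initial t G -> ~ legal A t -> size (rcons s (p, a)) <= size t].

Definition won (A : cgame) (p : player) (G : run) : Prop :=
  (legal_run A G /\ winner A G = p) \/ illegal_by A (~~ p) G.

Definition cstatic (A : cgame) : Prop :=
  forall (p : player) (G O : run), delay p O G -> won A p G -> won A p O.

(* Components are numbered from 1, up to n for [Some n] and without bound for
   [None]; the value at 0 of a family of games is never used. *)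
Definition in_range (N : option nat) (i : nat) : bool :=
  (1 <= i) && (if N is Some n then i <= n else true).

Definition numeral (i : nat) : String.string :=
  DecimalString.NilZero.string_of_uint (Nat.to_uint i).

(* The string i followed by a full stop (ASCII code 46). *)
Definition dotted (i : nat) : String.string :=
  String.append (numeral i)
    (String.String (Ascii.ascii_of_nat 46) String.EmptyString).

Definition switch_index (N : option nat) (m : labmove) : option nat :=
  match pselect (exists i, in_range N i /\ m.2 = numeral i) with
  | left H => Some (projT1 (cid H))
  | right _ => None
  end.

Definition wf_move (N : option nat) (p : player) (m : labmove) : Prop :=
  (exists i, in_range N i /\ m = (p, numeral i)) \/
  (exists i a, in_range N i /\ m.2 = String.append (dotted i) a).

(* [sequential] adds the condition that the switches are 2, 3, 4, ... *)
Definition tog_legal (sequential : bool) (N : option nat) (p : player)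
    (A : nat -> cgame) (s : position) : Prop :=
  [/\ forall m, List.In m s -> wf_move N p m,
      forall i, in_range N i -> legal (A i) (pmap (strip_lab (dotted i)) s) &
      sequential -> pmap (switch_index N) s
                    = iota 2 (size (pmap (switch_index N) s))].

(* The active component is the last switch, or 1 if there is none. *)
Definition tog_winner (N : option nat) (p : player)
    (A : nat -> cgame) (G : run) : player :=
  if `[< exists l : seq nat, pmap_fi (switch_index N) G = Fin l /\
           won (A (last 1 l)) p (proj (dotted (last 1 l)) G) >]
  then p else ~~ p.

Lemma tog_legal_nil b N p A : tog_legal b N p A [::].
Proof. by split=> // i _; exact: legal_nil. Qed.

Lemma tog_legal_prefix b N p A s t :
  tog_legal b N p A (s ++ t) -> tog_legal b N p A s.
Proof.
case=> wf lg sq; split.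
- by move=> m ms; apply: wf; apply/List.in_or_app; left.
- by move=> i /lg; rewrite pmap_cat; exact: legal_prefix.
- move=> /sq; rewrite pmap_cat size_cat => /(congr1 (take (size (pmap (switch_index N) s)))).
  by rewrite take_size_cat // take_iota (minn_idPl (leq_addr _ _)).
Qed.

Lemma numeral_neq0 i : numeral i <> String.EmptyString.
Proof. by rewrite /numeral; case: (Nat.to_uint i). Qed.

Lemma tog_illegal_move b N p A s (q : player) : tog_legal b N p A s ->
  exists a : move, ~ tog_legal b N p A (rcons s (q, a)).
Proof.
move=> _; exists String.EmptyString; case=> wf _ _.
have [|[i [_ [_ /esym/numeral_neq0 //]]]|[i [a [_]]]] := wf (q, String.EmptyString).
  by rewrite -cats1; apply/List.in_or_app; right; left.
rewrite /dotted /=; move: (@numeral_neq0 i).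
by case: (numeral i).
Qed.

(* The player making the switches is p: the disjunctions are the case Top and
   the conjunctions the case Bot. *)
Definition tog (sequential : bool) (N : option nat) (p : player)
    (A : nat -> cgame) : cgame :=
  @CGame (tog_legal sequential N p A) (tog_winner N p A)
    (@tog_legal_nil sequential N p A) (@tog_legal_prefix sequential N p A)
    (@tog_illegal_move sequential N p A).

Definition valuation (Var Const : Type) : Type := Var -> Const.
Definition game (Var Const : Type) : Type := valuation Var Const -> cgame.

Definition static (Var Const : Type) (A : game Var Const) : Prop :=
  forall e, cstatic (A e).

Section Operations.
Variables Var Const : Type.
Implicit Type A : nat -> game Var Const.

Definition tog_disj n A : game Var Const :=
  fun e => tog false (Some n) Top (fun i => A i e).
Definition tog_conj n A : game Var Const :=
  fun e => tog false (Some n) Bot (fun i => A i e).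
Definition seq_disj n A : game Var Const :=
  fun e => tog true (Some n) Top (fun i => A i e).
Definition seq_conj n A : game Var Const :=
  fun e => tog true (Some n) Bot (fun i => A i e).

Definition tog_disj_inf A : game Var Const :=
  fun e => tog false None Top (fun i => A i e).
Definition tog_conj_inf A : game Var Const :=
  fun e => tog false None Bot (fun i => A i e).
Definition seq_disj_inf A : game Var Const :=
  fun e => tog true None Top (fun i => A i e).
Definition seq_conj_inf A : game Var Const :=
  fun e => tog true None Bot (fun i => A i e).

End Operations.

(* Main.v *)
Require Import Defs.
From mathcomp Require Import all_boot.
From mathcomp Require Import boolp classical_sets.
From Stdlib Require Ascii String DecimalString.

(* Legality is propagated through delays at the level of positions.  Say that s
   lags behind t for p if s has the moves of p in t up to some point, t has the
   moves of the adversary in s up to some point, and no move of p comes earlier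
   in s, relative to the moves of the adversary, than in t.  In a static game a
   move of p ending a position s cannot be the first illegal one if s lags behind
   a legal t: otherwise, by [illegal_move], both positions extend to runs, one a
   p-delay of the other, of which the delayed one is lost by the adversary and
   the delay by p.  This property is inherited by the toggling and sequential
   operations, because lagging is preserved by projections and all legal
   switches are made by one player; it implies that in a compound game a
   p-illegal p-delay comes only from a p-illegal run.  Between legal runs a delay
   preserves the switches, hence the active component, and restricts to a delay
   in it, where staticity of that component decides the winner.  The case of the
   player who does not switch follows because G is a delay of O for the adversary
   of p whenever O is a p-delay of G. *)

Set Implicit Arguments.
Unset Strict Implicit.
Unset Printing Implicit Defensive.

(** * Prefixes of finite and infinite sequences *)

Section Prefix.
Variable T : Type.
Implicit Types (s t u : seq T) (G H : fiseq T).

Definition pre s t : Prop := exists u, t = s ++ u.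

Lemma pre_refl s : pre s s.
Proof. by exists [::]; rewrite cats0. Qed.

Lemma pre_trans s t u : pre s t -> pre t u -> pre s u.
Proof. by move=> [x ->] [y ->]; exists (x ++ y); rewrite catA. Qed.

Lemma pre_size s t : pre s t -> size s <= size t.
Proof. by move=> [u ->]; rewrite size_cat leq_addr. Qed.

Lemma pre_takeE s t : pre s t -> s = take (size s) t.
Proof. by move=> [u ->]; rewrite take_size_cat. Qed.

Lemma pre_take n s : pre (take n s) s.
Proof. by exists (drop n s); rewrite cat_take_drop. Qed.

Lemma pre_comparable s t u : pre s u -> pre t u -> size s <= size t -> pre s t.
Proof.
move=> /pre_takeE es /pre_takeE et le; rewrite es et -(@take_takel _ (size s) (size t)) //.
exact: pre_take.
Qed.

Lemma pre_size_eq s t : pre s t -> size t <= size s -> s = t.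
Proof. by move=> /pre_takeE e le; rewrite e take_oversize. Qed.

Lemma pre_rcons s t (x : T) : pre s (rcons t x) -> pre s t \/ s = rcons t x.
Proof.
move=> h; have [le|lt] := leqP (size s) (size t).
  by left; apply: (pre_comparable h) le; exists [:: x]; rewrite cats1.
by right; apply: pre_size_eq; rewrite // size_rcons.
Qed.

Lemma pre_cat s t u : pre s (t ++ u) -> pre s t \/ exists2 v, s = t ++ v & pre v u.
Proof.
move=> h; have [le|lt] := leqP (size s) (size t).
  by left; apply: (pre_comparable h) le; exists u.
right; exists (take (size s - size t) u); last exact: pre_take.
by rewrite [LHS](pre_takeE h) take_cat ltnNge ltnW.
Qed.

Lemma take_upto n m G : n <= m -> take n (upto m G) = upto n G.
Proof.
case: G => [s|f] le /=; first exact: take_takel.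
by rewrite -map_take take_iota (minn_idPl le).
Qed.

Lemma uptoS n G : upto n.+1 G = oapp (rcons (upto n G)) (upto n G) (item G n).
Proof.
case: G => [s|f] /=; last exact: mkseqS.
by elim: s n => [|x s IH] [|n] //=; rewrite ?take0 // IH; case: (onth s n).
Qed.

Lemma upto0 G : upto 0 G = [::].
Proof. by case: G => //= s; rewrite take0. Qed.

Lemma initial_upto n G : initial (upto n G) G.
Proof. by exists n. Qed.

Lemma upto_pre n m G : n <= m -> pre (upto n G) (upto m G).
Proof. by move=> /(take_upto G) <-; exact: pre_take. Qed.

Lemma initial_pre s t G : pre s t -> initial t G -> initial s G.
Proof.
move=> /pre_takeE -> [n ->]; have [le|/ltnW lt] := leqP (size s) n.
  by rewrite take_upto //; exact: initial_upto.
rewrite take_oversize; first exact: initial_upto.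
apply: leq_trans lt; case: G => [r|f] /=; last by rewrite size_mkseq.
by rewrite size_take_min geq_minl.
Qed.

Lemma initial_comparable s t G :
  initial s G -> initial t G -> size s <= size t -> pre s t.
Proof.
move=> [n ->] [m ->]; have [le _|/ltnW lt le] := leqP n m; first exact: upto_pre.
by rewrite (pre_size_eq (upto_pre G lt) le); exact: pre_refl.
Qed.

Lemma initial_Fin s t : initial s (Fin t) <-> pre s t.
Proof.
split=> [[n ->]|/pre_takeE ->]; first exact: pre_take.
by exists (size s).
Qed.

(** The hypotheses give both sequences the same finite initial segments; a finite sequence has a
    longest one, an infinite sequence has none. Equality of runs thus becomes a matter of
    positions. *)
Lemma fiseq_ext G H :
  (forall s, initial s G -> exists2 t, initial t H & pre s t) ->
  (forall s, initial s H -> exists2 t, initial t G & pre s t) -> G = H.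
Proof.
have sub G1 H1 : (forall s, initial s G1 -> exists2 t, initial t H1 & pre s t) ->
    forall s, initial s G1 -> initial s H1.
  by move=> h s /h [t it st]; exact: initial_pre it.
have no s f : (forall t, initial t (Inf f) -> initial t (Fin s)) -> False.
  move=> h; have /h /initial_Fin /pre_size := initial_upto (size s).+1 (Inf f).
  by rewrite /upto size_mkseq ltnn.
move=> /sub gh /sub hg; case: G H gh hg => [s|f] [t|g] gh hg.
- have /gh /initial_Fin st : initial s (Fin s) by apply/initial_Fin/pre_refl.
  have /hg /initial_Fin ts : initial t (Fin t) by apply/initial_Fin/pre_refl.
  by rewrite (pre_size_eq st (pre_size ts)).
- by case: (no s g).
- by case: (no t f).
congr Inf; apply/funext => n.
have [m e] := gh _ (initial_upto n.+1 (Inf f)).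
have em : n.+1 = m by move: (congr1 size e); rewrite /upto !size_mkseq.
by move: e; rewrite -em /upto !mkseqS => /rcons_inj [].
Qed.
End Prefix.

(** * Subsequences selected by a partial map *)

Section Pmap.
Variables (T U : Type) (g : T -> option U).
Implicit Types (s t : seq T) (G : fiseq T).

Lemma pre_pmap s t : pre s t -> pre (pmap g s) (pmap g t).
Proof. by move=> [u ->]; exists (pmap g u); rewrite pmap_cat. Qed.

Lemma take_pmap n s : exists m, take n (pmap g s) = pmap g (take m s).
Proof.
elim: s n => [|x s IH] [|n]; do ?by exists 0; rewrite ?take0.
rewrite /=; case e: (g x) => [y|] /=.
  by have [m em] := IH n; exists m.+1; rewrite /= e /= em.
by have [m em] := IH n.+1; exists m.+1; rewrite /= e /= em.
Qed.

Lemma pre_pmap_upto u n G : pre u (pmap g (upto n G)) ->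
  exists n, u = pmap g (upto n G).
Proof.
move=> /pre_takeE ->.
have [m ->] := take_pmap (size u) (upto n G).
have [k ->] := initial_pre (pre_take m _) (initial_upto n G).
by exists k.
Qed.

Lemma pmap_mkseq_stable f M N : (forall k, M <= k -> g (f k) = None) -> M <= N ->
  pmap g (mkseq f N) = pmap g (mkseq f M).
Proof.
move=> h; elim: N => [|N IH]; first by rewrite leqn0 => /eqP ->.
rewrite leq_eqVlt => /orP[/eqP -> //|]; rewrite ltnS => le.
by rewrite mkseqS -cats1 pmap_cat /= h //= cats0 IH.
Qed.

(** Removes the choices made in [pmap_fi]: from here on only finite segments of the image are
    handled. *)
Lemma initial_pmap_fi u G :
  initial u (pmap_fi g G) <-> exists n, u = pmap g (upto n G).
Proof.
case: G => [s|f].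
  split=> [i|[n ->]]; last by apply/initial_Fin/pre_pmap/pre_take.
  by apply: (@pre_pmap_upto _ (size s)); rewrite /= take_size; apply/initial_Fin.
rewrite /pmap_fi; case: pselect => [H|nH].
  set h := fun n => _.
  (* The value picked at an index does not depend on the truncation that exhibits it: truncations
     are nested, and so are their images. *)
  have hP N n : n <= size (pmap g (mkseq f N)) -> mkseq h n = take n (pmap g (mkseq f N)).
    elim: n => [|n IH] lt; first by rewrite take0.
    rewrite mkseqS IH 1?ltnW //.
    have [M eM] : exists M, onth (pmap g (mkseq f M)) n = Some (h n).
      exact: (projT2 (cid (H n))).
    have eN : onth (pmap g (mkseq f N)) n = Some (h n).
      have [le|/ltnW le] := leqP M N.
        have [w ->] := pre_pmap (upto_pre (Inf f) le).
        by rewrite onth_cat -onthTE eM.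
      have [w ew] := pre_pmap (upto_pre (Inf f) le).
      by move: eM; rewrite ew onth_cat lt.
    by have := uptoS n (Fin (pmap g (mkseq f N))); rewrite /= eN => ->.
  split=> [[n ->]|[N ->]].
    have [v [N eN]] := H n; apply: (@pre_pmap_upto _ N).
    rewrite /= (hP N); first exact: pre_take.
    by apply: ltnW; rewrite -onthTE eN.
  by exists (size (pmap g (upto N (Inf f)))); rewrite /= (hP N) // take_size.
have exM : exists M, forall k, M <= k -> g (f k) = None.
  apply: contrapT => nM; apply: nH.
  (* Were [g] defined at arbitrarily late indices, the images of the truncations would have
     unbounded length, against [nH]. *)
  have big n : exists N, n <= size (pmap g (mkseq f N)).
    elim: n => [|n [N IH]]; first by exists 0.
    have [k le gk] : exists2 k, N <= k & g (f k) <> None.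
      apply: contrapT => nk; apply: nM; exists N => k le.
      by apply: contrapT => gk; apply: nk; exists k.
    exists k.+1; rewrite mkseqS -cats1 pmap_cat size_cat /=.
    case e: (g (f k)) gk => [y|[]] // _ /=; rewrite addn1 ltnS.
    exact: leq_trans IH (pre_size (pre_pmap (upto_pre (Inf f) le))).
  move=> n; have [N] := big n.+1; rewrite -onthTE.
  by case e: onth => [v|//] _; exists v, N.
have := @xgetPex _ 0 [set M | forall k, M <= k -> g (f k) = None]%classic exM.
set M := xget _ _ => /= MP; split=> [i|[N ->]].
  exact: (@pre_pmap_upto _ M (Inf f) (proj1 (initial_Fin _ _) i)).
apply/initial_Fin; have [le|/ltnW le] := leqP N M.
  exact: (pre_pmap (upto_pre (Inf f) le)).
by rewrite /= (pmap_mkseq_stable MP le); exact: pre_refl.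
Qed.
End Pmap.

(** * Delays in terms of positions *)

Definition mv (p : player) (s : position) : position := [seq m <- s | m.1 == p].

Lemma mvE p s : pmap (fun m : labmove => if m.1 == p then Some m else None) s = mv p s.
Proof. by elim: s => //= m s ->; case: eqP. Qed.

Lemma mv_cat p s t : mv p (s ++ t) = mv p s ++ mv p t.
Proof. exact: filter_cat. Qed.

Lemma mv_rcons p s m :
  mv p (rcons s m) = if m.1 == p then rcons (mv p s) m else mv p s.
Proof. exact: filter_rcons. Qed.

Lemma pre_mv p s t : pre s t -> pre (mv p s) (mv p t).
Proof. by move=> [u ->]; exists (mv p u); rewrite mv_cat. Qed.

Lemma mv_id p s : mv p (mv p s) = mv p s.
Proof. by rewrite /mv filter_id. Qed.

Lemma mvN p s : mv (~~ p) (mv p s) = [::].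
Proof. by elim: s => //= -[q a] s /=; case: p; case: q. Qed.

Lemma in_mv p s a : List.In (p, a) s -> List.In (p, a) (mv p s).
Proof.
elim: s => //= m s IH [->|/IH]; first by rewrite eqxx; left.
by case: eqP => //; right.
Qed.

Lemma mv_in p s m : List.In m (mv p s) -> List.In m s.
Proof. by elim: s => //= x s IH; case: eqP => _ /=; [case; auto|auto]. Qed.

Lemma size_mv_upto p G n m : n <= m -> size (mv p (upto n G)) <= size (mv p (upto m G)).
Proof. by move=> /(upto_pre G)/(pre_mv p)/pre_size. Qed.

(** The number of moves of [p] grows by at most one with each item, so no value is skipped. *)
Lemma nth_at_exists p n a (G : run) : 1 <= n <= size (mv p (upto a G)) ->
  exists2 i, i < a & nth_at p n G i.
Proof.
elim: a => [|a IH] /andP[n0].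
  by rewrite upto0 leqNgt n0.
have [le _|lt] := leqP n (size (mv p (upto a G))).
  by have [|i lt h] := IH; [rewrite n0|exists i => //; exact: ltnW].
have := uptoS a G; case e: (item G a) => [[q b]|] /= eu; last first.
  by rewrite eu leqNgt lt.
rewrite {1}eu mv_rcons /=; case: eqP => [eq|_]; last by rewrite leqNgt lt.
rewrite size_rcons => le; exists a => //; split; first by exists b; rewrite e eq.
rewrite -size_filter -/(mv p _) eu mv_rcons /= eq eqxx size_rcons.
by apply/eqP; rewrite eqn_leq lt.
Qed.

Lemma nth_at_before p n (G : run) i : nth_at p n G i ->
  [/\ size (mv p (upto i.+1 G)) = n, (size (mv p (upto i G))).+1 = n &
      mv (~~ p) (upto i.+1 G) = mv (~~ p) (upto i G)].
Proof.
move=> [[a e]]; rewrite -size_filter -/(mv p _) uptoS e /= !mv_rcons /= eqxx size_rcons.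
by move=> ->; split=> //; case: (p).
Qed.

Definition sub_moves p (O G : run) : Prop :=
  forall s, initial s O -> exists2 t, initial t G & pre (mv p s) (mv p t).

(** Clause (2) of a delay without counting. For runs with the same moves of each player, a failing
    pair means that a move of [p] overtakes an adversary move. The form is symmetric under
    exchanging both the players and the runs. *)
Definition slower p (O G : run) : Prop :=
  forall s t, initial s O -> initial t G ->
    pre (mv p s) (mv p t) \/ pre (mv (~~ p) t) (mv (~~ p) s).

Lemma sub_moves_size p O G s t : sub_moves p O G -> initial s O -> initial t G ->
  size (mv p s) <= size (mv p t) -> pre (mv p s) (mv p t).
Proof.
move=> h /h [t' it' st'] it le.
have [/(initial_comparable it it')|/ltnW/(initial_comparable it' it)] := leqP (size t) (size t').
  by move=> /(pre_mv p) tt'; exact: (pre_comparable st' tt').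
by move=> /(pre_mv p); exact: pre_trans st'.
Qed.

Lemma initial_moves_of p s G :
  initial s (moves_of p G) <-> exists n, s = mv p (upto n G).
Proof. by rewrite initial_pmap_fi; split=> -[n ->]; exists n; rewrite mvE. Qed.

Lemma moves_ofP p O G :
  moves_of p O = moves_of p G <-> sub_moves p O G /\ sub_moves p G O.
Proof.
have half O1 G1 : moves_of p O1 = moves_of p G1 -> sub_moves p O1 G1.
  move=> e s [n ->].
  have /initial_moves_of [m ->] : initial (mv p (upto n O1)) (moves_of p G1).
    by rewrite -e; apply/initial_moves_of; exists n.
  by exists (upto m G1); [exact: initial_upto|exact: pre_refl].
split=> [e|[h1 h2]]; first by split; apply: half.
apply: fiseq_ext => s /initial_moves_of [n ->].
  have [_ [m ->] st] := h1 _ (initial_upto n O).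
  by exists (mv p (upto m G)) => //; apply/initial_moves_of; exists m.
have [_ [m ->] st] := h2 _ (initial_upto n G).
by exists (mv p (upto m O)) => //; apply/initial_moves_of; exists m.
Qed.

Lemma delayP p O G : delay p O G <->
  (forall q, sub_moves q O G /\ sub_moves q G O) /\ slower p O G.
Proof.
split=> [[em ord]|[sm sl]].
  have sm q := proj1 (moves_ofP q O G) (em q); split=> // s t is_ it.
  have [le|lt] := leqP (size (mv p s)) (size (mv p t)).
    by left; apply: sub_moves_size is_ it le; case: (sm p).
  have [le|lt'] := leqP (size (mv (~~ p) t)) (size (mv (~~ p) s)).
    by right; apply: sub_moves_size it is_ le; case: (sm (~~ p)).
  (* If both inclusions fail, the [n]-th move of [p] follows the [k]-th adversary move in [G], but
     in [O] it lies in [upto a O], which has fewer than [k] adversary moves. *)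
  exfalso; case: is_ it lt lt' => a -> [b ->].
  set n := size (mv p (upto a _)); set k := size (mv (~~ p) (upto b _)) => lt lt'.
  have n0 : 1 <= n by exact: leq_ltn_trans lt.
  have k0 : 1 <= k by exact: leq_ltn_trans lt'.
  have [j jb hj] : exists2 j, j < b & nth_at (~~ p) k G j.
    by apply: nth_at_exists; rewrite k0 leqnn.
  have [c nc] : exists c, n <= size (mv p (upto c G)).
    by have [_ [c ->] /pre_size] := (sm p).1 _ (initial_upto a O); exists c.
  have [i _ hi] : exists2 i, i < c & nth_at p n G i.
    by apply: nth_at_exists; rewrite n0 nc.
  have bi : b <= i.
    rewrite leqNgt; apply/negP => ib; have [e _ _] := nth_at_before hi.
    by have := size_mv_upto p G ib; rewrite e leqNgt lt.
  have [] := ord n k n0 k0.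
    by exists i, j; split=> //; exact: leq_trans jb bi.
  move=> i' [j' [hi' hj' ji']].
  have [_ ei' _] := nth_at_before hi'; have [ej' _ _] := nth_at_before hj'.
  have ia : i' < a.
    rewrite ltnNge; apply/negP => /(size_mv_upto p O).
    by rewrite -/n -ei' ltnn.
  have := size_mv_upto (~~ p) O (leq_trans ji' (ltnW ia)).
  by rewrite ej' leqNgt lt'.
split=> [q|n k n0 k0 [i [j [hi hj ji]]]]; first exact/moves_ofP.
have [ei ei' _] := nth_at_before hi; have [ej _ _] := nth_at_before hj.
have [c nc] : exists c, n <= size (mv p (upto c O)).
  have [_ [c ->] /pre_size] := (sm p).2 _ (initial_upto i.+1 G).
  by rewrite ei; exists c.
have [i' _ hi'] : exists2 i', i' < c & nth_at p n O i'.
  by apply: nth_at_exists; rewrite n0.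
have [f1 f2 f3] := nth_at_before hi'.
(* [O] is cut just after its [n]-th move of [p] and [G] just before; the counts [n] and [n - 1]
   leave only the second alternative of [slower]. *)
have kle : k <= size (mv (~~ p) (upto i' O)).
  have [/pre_size|/pre_size] := sl _ _ (initial_upto i'.+1 O) (initial_upto i G).
    by rewrite f1 -ei' ltnn.
  by rewrite f3; apply: leq_trans; rewrite -ej; exact: size_mv_upto.
have [j' ji' hj'] : exists2 j', j' < i' & nth_at (~~ p) k O j'.
  by apply: nth_at_exists; rewrite k0.
by exists i', j'.
Qed.

Lemma slower_sym p O G : slower p O G -> slower (~~ p) G O.
Proof. by move=> h s t is_ it; rewrite negbK; case: (h _ _ it is_); [right|left]. Qed.

Lemma delay_sym p O G : delay p O G -> delay (~~ p) G O.
Proof.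
move=> /delayP [sm sl]; apply/delayP; split; last exact: slower_sym.
by move=> q; have [] := sm q.
Qed.

(** * Projections of delays to components *)

Lemma mv_strip p a s : mv p (pmap (strip_lab a) s) = pmap (strip_lab a) (mv p s).
Proof.
elim: s => //= -[q m] s IH; rewrite /strip_lab /=.
by case e: strip => [x|] /=; case: eqP => //= _; rewrite ?e /= IH.
Qed.

Lemma slower_proj p O G a : slower p O G -> slower p (proj a O) (proj a G).
Proof.
move=> sl s t /initial_pmap_fi [n ->] /initial_pmap_fi [m ->]; rewrite !mv_strip.
case: (sl _ _ (initial_upto n O) (initial_upto m G)) => h.
  by left; exact: pre_pmap.
by right; exact: pre_pmap.
Qed.

Lemma delay_proj p O G a : delay p O G -> delay p (proj a O) (proj a G).
Proof.
have half q O1 G1 : sub_moves q O1 G1 -> sub_moves q (proj a O1) (proj a G1).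
  move=> h s /initial_pmap_fi [n ->].
  have [_ [m ->] /(pre_pmap (strip_lab a)) st] := h _ (initial_upto n O1).
  exists (pmap (strip_lab a) (upto m G1)); last by rewrite !mv_strip.
  by apply/initial_pmap_fi; exists m.
move=> /delayP [sm sl]; apply/delayP; split; last exact: slower_proj.
by move=> q; have [h1 h2] := sm q; split; apply: half.
Qed.

Lemma eqb_negb_self (b : bool) : (b == ~~ b) = false.
Proof. by case: b. Qed.

(** * Illegality and winning in a constant game *)

Lemma legal_pre A s t : pre s t -> legal A t -> legal A s.
Proof. by move=> [u ->]; exact: legal_prefix. Qed.

Lemma first_illegal A s : ~ legal A s -> exists t q b,
  [/\ pre (rcons t (q, b)) s, legal A t & ~ legal A (rcons t (q, b))].
Proof.
elim/last_ind: s => [|s [q b] IH] nl; first by case: nl; exact: legal_nil.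
have [ls|/IH [t [r [c [ts lt nlt]]]]] := pselect (legal A s).
  by exists s, q, b; split=> //; exact: pre_refl.
exists t, r, c; split=> //; apply: pre_trans ts _.
by exists [:: (q, b)]; rewrite cats1.
Qed.

Lemma illegal_byP A p G : illegal_by A p G <->
  exists s a, [/\ initial (rcons s (p, a)) G, legal A s & ~ legal A (rcons s (p, a))].
Proof.
have pres s m : pre s (rcons s m) by exists [:: m]; rewrite cats1.
split=> -[s [a []]].
  move=> i nl min; exists s, a; split=> //; apply: contrapT => /min.
  by rewrite size_rcons ltnn => h; apply/notF/h; exact: initial_pre i.
move=> i ls nl; exists s, a; split=> // t it nlt; rewrite leqNgt; apply/negP => lt.
have [ts|e] := pre_rcons (initial_comparable it i (ltnW lt)).
  exact/nlt/(legal_pre ts).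
by move: lt; rewrite e ltnn.
Qed.

Lemma legal_or_illegal A G : legal_run A G \/ exists p, illegal_by A p G.
Proof.
have [l|nl] := pselect (legal_run A G); [by left|right].
have [s is_ nls] : exists2 s, initial s G & ~ legal A s.
  apply: contrapT => h; apply: nl => s is_; apply: contrapT => nls.
  by apply: h; exists s.
have [t [p [a [ts lt nlt]]]] := first_illegal nls.
by exists p; apply/illegal_byP; exists t, a; split=> //; exact: initial_pre is_.
Qed.

Lemma illegal_not_legal A p G : illegal_by A p G -> ~ legal_run A G.
Proof. by move=> /illegal_byP [s [a [i _ nl]]] /(_ _ i). Qed.

Lemma illegal_unique A p G : illegal_by A p G -> ~ illegal_by A (~~ p) G.
Proof.
move=> [s [a [is_ nls mins]]] [t [b [it nlt mint]]].
have e : rcons s (p, a) = rcons t (~~ p, b).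
  apply: pre_size_eq (mint _ is_ nls); apply: (initial_comparable is_ it).
  exact: mins.
by case/rcons_inj: e => _ /esym; case: (p).
Qed.

Lemma won_unique A p G : won A p G -> ~ won A (~~ p) G.
Proof.
move=> [[l <-]|il] [[l' e]|il'].
- by move: e; case: (winner A G).
- exact: illegal_not_legal il' l.
- exact: illegal_not_legal il l'.
- exact: illegal_unique il il'.
Qed.

(** * Lagging positions and first illegal moves *)

Lemma pre_mvE p s t : pre (mv p s) (mv p t) -> exists u, mv p t = mv p s ++ mv p u.
Proof. by move=> [u e]; exists u; rewrite -[LHS]mv_id e mv_cat mv_id. Qed.

(* The relation in which a finite part of a delay stands to a finite part of
   the delayed run: s may lack moves of p, and t moves of the adversary. *)
Definition lag p (s t : position) : Prop :=
  [/\ pre (mv p s) (mv p t), pre (mv (~~ p) t) (mv (~~ p) s) &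
      slower p (Fin s) (Fin t)].

(** A trace of staticity that speaks of positions only, not of winners; this is what lets it pass to
    compound games. *)
Definition lag_legal (A : cgame) : Prop := forall p s a t,
  lag p (rcons s (p, a)) t -> legal A t -> legal A s -> legal A (rcons s (p, a)).

(** Either a move of [mv p r] is already illegal, or [illegal_move] supplies a bad last move. All
    added moves belong to [p], so [p] is to blame in both cases. *)
Lemma illegal_extension A p s r : legal A s -> exists a,
  illegal_by A p (Fin (rcons (s ++ mv p r) (p, a))).
Proof.
elim: r s => [|[q b] r IH] s ls /=.
  have [a na] := illegal_move p ls; exists a; apply/illegal_byP; exists s, a.
  by rewrite cats0; split=> //; apply/initial_Fin/pre_refl.
case: eqP => [->|_]; last exact: IH.
rewrite -cat_rcons; have [l|nl] := pselect (legal A (rcons s (p, b))).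
  exact: IH.
exists b; apply/illegal_byP; exists s, b; split=> //.
by apply/initial_Fin; rewrite rcons_cat; exists (rcons (mv p r) (p, b)).
Qed.

(* Completing the two positions to a pair of runs in delay, with an illegal
   move of the adversary put after t and after s, makes the run extending t
   won by p, hence so is the one extending s. *)
Lemma static_lag_legal A : cstatic A -> lag_legal A.
Proof.
move=> st p s a t; set s' := rcons s (p, a) => -[/pre_mvE [x ex] /pre_mvE [y ey] sl] lt ls.
apply: contrapT => nl; have [b ilb] := illegal_extension (~~ p) y lt.
set G := rcons _ _ in ilb; pose O := rcons s' (~~ p, b) ++ mv p x.
have mvb : mv p [:: (~~ p, b)] = [::] by rewrite /=; case: (p).
have mvb' : mv (~~ p) [:: (~~ p, b)] = [:: (~~ p, b)] by rewrite /= eqxx.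
have eG : G = t ++ mv (~~ p) y ++ [:: (~~ p, b)] by rewrite catA cats1.
have eO : O = s' ++ [:: (~~ p, b)] ++ mv p x by rewrite catA cats1.
have mvN' r : mv p (mv (~~ p) r) = [::] by rewrite -{1}[p]negbK mvN.
have ep : mv p O = mv p G by rewrite eO eG !mv_cat mvb mvN' mv_id !cats0 ex.
have en : mv (~~ p) O = mv (~~ p) G.
  by rewrite eO eG !mv_cat mvb' mvN mv_id cats0 ey -!catA.
have dl : delay p (Fin O) (Fin G).
  apply/delayP; split.
    have em q : mv q O = mv q G by case: (q) (p) ep en => -[].
    move=> q; split=> u /initial_Fin/(pre_mv q).
      by rewrite em; exists G => //; apply/initial_Fin/pre_refl.
    by rewrite -em; exists O => //; apply/initial_Fin/pre_refl.
  move=> u v /initial_Fin uO /initial_Fin vG.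
  (* A segment of [O] that stops within [s'] is compared through [sl], or with a segment of [G]
     containing all of [t]; a longer one already has every adversary move of [O]. *)
  have [us'|su] : pre u s' \/ pre (rcons s' (~~ p, b)) u.
    have [us|[w -> _]] := pre_cat uO.
      have [|->] := pre_rcons us; first by left.
      by right; exact: pre_refl.
    by right; exists w.
  - move: (vG); rewrite eG => /pre_cat [vt|[w ev _]].
      by apply: sl; apply/initial_Fin.
    left; apply: pre_trans (pre_mv p us') _; rewrite ev mv_cat ex -catA.
    by exists (mv p x ++ mv p w).
  - right; apply: pre_trans (pre_mv _ vG) _; rewrite -en /O mv_cat mvN cats0.
    exact: pre_mv.
have wG : won A p (Fin G) by right.
have ilO : illegal_by A p (Fin O).
  apply/illegal_byP; exists s, a; split=> //; apply/initial_Fin.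
  by rewrite eO; eexists.
by apply: (won_unique (st _ _ _ dl wG)); right; rewrite negbK.
Qed.

(** The segment taken is the shortest one of [G] with all the moves of [p] in [rcons s (p, a)]. By
    minimality it ends with a move of [p], and [slower], applied just before that move, bounds its
    adversary moves. *)
Lemma lag_truncate p O G s a :
  sub_moves p O G -> slower p O G -> initial (rcons s (p, a)) O ->
  exists t b, [/\ initial (rcons t (p, b)) G, lag p (rcons s (p, a)) (rcons t (p, b)) &
    forall u, initial u G -> pre (mv p (rcons s (p, a))) (mv p u) ->
      pre (rcons t (p, b)) u].
Proof.
set s' := rcons _ _ => sub sl is'.
have : exists n, `[< pre (mv p s') (mv p (upto n G)) >].
  by have [_ [n ->] h] := sub _ is'; exists n; apply/asboolP.
move=> /ex_minnP [[|n] /asboolP sn min].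
  by move/pre_size: sn; rewrite upto0 mv_rcons eqxx size_rcons.
have nsn : ~ pre (mv p s') (mv p (upto n G)).
  by move=> /asboolP/min; rewrite ltnn.
have [[q b] ei] : exists m, item G n = Some m.
  by case: (item G n) (uptoS n G) => [m|] /= e; [exists m|rewrite -e in nsn].
have eu : upto n.+1 G = rcons (upto n G) (q, b) by rewrite uptoS ei.
have eq : q = p.
  by apply/eqP/negPn/negP => /negbTE ne; move: sn; rewrite eu mv_rcons /= ne.
rewrite {}eq {q ei} in eu; exists (upto n G), b; rewrite -eu.
split; first exact: initial_upto.
  split=> //.
    rewrite eu mv_rcons /= eqb_negb_self.
    by have [/nsn|] := sl _ _ is' (initial_upto n G).
  move=> u v /initial_Fin us /initial_Fin vn.
  by apply: sl; [exact: initial_pre us is'|exact: initial_pre vn (initial_upto _ _)].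
move=> _ [k ->] /asboolP/min; exact: upto_pre.
Qed.

Lemma lag_legal_delay A p O G : lag_legal A -> delay p O G ->
  illegal_by A p O -> illegal_by A p G.
Proof.
move=> Q /delayP [sm sl] /illegal_byP [s [a [is_ ls nls]]].
have [t [b [it lag_st _]]] := lag_truncate (sm p).1 sl is_.
have /first_illegal [u [q [c [ut lu nlu]]]] : ~ legal A (rcons t (p, b)).
  by move=> lt; apply: nls; exact: Q lag_st lt ls.
have iu := initial_pre ut it.
have [eq|eq] : q = p \/ q = ~~ p by case: (q) (p) => -[]; auto.
  by rewrite eq in iu nlu; apply/illegal_byP; exists u, c.
(* If the adversary errs first in [G], the roles are exchanged: the segment of [O] matching the
   error lies within the legal [s], so the erring move would be legal. *)
rewrite {}eq in iu ut nlu; exfalso; apply: nlu.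
have [v [d [iv lag_uv min]]] := lag_truncate (sm (~~ p)).2 (slower_sym sl) iu.
apply: (Q _ _ _ _ lag_uv _ lu); apply: legal_pre ls; apply: min.
  by apply: initial_pre is_; exists [:: (p, a)]; rewrite cats1.
have [_ /(pre_trans (pre_mv _ ut)) + _] := lag_st.
by rewrite [mv _ (rcons s _)]mv_rcons /= eqb_negb_self.
Qed.

(** * Switches and component moves as strings *)

Fixpoint has_dot (s : String.string) : bool :=
  if s is String.String c s' then Ascii.eqb c (Ascii.ascii_of_nat 46) || has_dot s'
  else false.

Lemma has_dot_append s t : has_dot (String.append s t) = has_dot s || has_dot t.
Proof. by elim: s => //= c s ->; rewrite orbA. Qed.

Lemma numeral_dot i : has_dot (numeral i) = false.
Proof.
rewrite /numeral; have h u : has_dot (DecimalString.NilEmpty.string_of_uint u) = false.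
  by elim: u.
by case: (Nat.to_uint i) => // u; exact: h.
Qed.

(** A full stop occurs in every dotted move but in no numeral. *)
Lemma dotted_not_numeral i j a : String.append (dotted i) a <> numeral j.
Proof. by move=> /(congr1 has_dot); rewrite numeral_dot !has_dot_append orbT. Qed.

Lemma switch_index_range N m i : switch_index N m = Some i -> in_range N i.
Proof.
by rewrite /switch_index; case: pselect => // H [<-]; case: (projT2 (cid H)).
Qed.

Lemma switch_index_adversary N p m : wf_move N p m -> m.1 = ~~ p ->
  switch_index N m = None.
Proof.
move=> [[i [_ ->]] /=|[i [a [_ em]]] _]; first by case: p.
rewrite /switch_index; case: pselect => // H; exfalso; case: H => j [_].
by rewrite em; exact: dotted_not_numeral.
Qed.

(** Makes the switches a function of the moves of [p] alone, which a delay keeps in order. *)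
Lemma switches_mv N p s : (forall m, List.In m s -> wf_move N p m) ->
  pmap (switch_index N) s = pmap (switch_index N) (mv p s).
Proof.
elim: s => //= m s IH wf; rewrite IH; last by move=> x xs; apply: wf; right.
case: eqP => //= /eqP ne; rewrite (@switch_index_adversary N p) //.
  by apply: wf; left.
by case: (m.1) (p) ne => -[].
Qed.

Lemma last_switch_range N s : in_range N 1 ->
  in_range N (last 1 (pmap (switch_index N) s)).
Proof.
elim/last_ind: s => //= s m IH r1; rewrite -cats1 pmap_cat /=.
case e: switch_index => [i|]; rewrite /= ?cats0; last exact: IH.
by rewrite cats1 last_rcons; exact: switch_index_range e.
Qed.

(** * Staticity of the compound games *)

Lemma lag_strip p a s t : lag p s t ->
  lag p (pmap (strip_lab a) s) (pmap (strip_lab a) t).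
Proof.
move=> [h1 h2 h3]; split; try by rewrite !mv_strip; exact: pre_pmap.
exact: (@slower_proj p (Fin s) (Fin t)).
Qed.

Lemma tog_lag_legal b N p A : (forall i, in_range N i -> lag_legal (A i)) ->
  lag_legal (tog b N p A).
Proof.
move=> Q q s a t lag_st [wft lgt sqt] [wfs lgs sqs].
(* The new move is well formed because, by lagging, it occurs in the legal [t]. *)
have wf m : List.In m (rcons s (q, a)) -> wf_move N p m.
  rewrite -cats1 => /List.in_app_iff [/wfs //|[<-|//]]; apply/wft/(@mv_in q).
  have [[x ->] _ _] := lag_st; apply/List.in_app_iff; left; apply: in_mv.
  by rewrite -cats1; apply/List.in_app_iff; right; left.
split=> //.
  (* In component [i] the new move either disappears or ends the projection, where the property of
     [A i] applies. *)
  move=> i ri; have := lag_strip (dotted i) lag_st.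
  rewrite -cats1 pmap_cat /= /strip_lab /=.
  case: strip => [c|] /=; last by rewrite cats0 => _; exact: lgs.
  rewrite cats1 => lag_i; exact: Q (lgt _ ri) (lgs _ ri).
(* After a move of the switching player the switches are an initial part of those of [t]; an
   adversary move adds none. *)
move=> /[dup] /sqs es /sqt et; have [eq|ne] := eqVneq q p.
  rewrite eq in lag_st wf *.
  have [/(pre_pmap (switch_index N)) + _ _] := lag_st.
  rewrite -(switches_mv wf) -(switches_mv wft) => h; rewrite {1}(pre_takeE h) et take_iota.
  by rewrite (minn_idPl (pre_size h)).
rewrite -cats1 pmap_cat /= (@switch_index_adversary N p) ?cats0 //.
  by apply: wf; rewrite -cats1; apply/List.in_app_iff; right; left.
by case: (q) (p) ne => -[].
Qed.

Lemma switches_delay b N p q A O G : delay q O G ->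
  legal_run (tog b N p A) O -> legal_run (tog b N p A) G ->
  pmap_fi (switch_index N) O = pmap_fi (switch_index N) G.
Proof.
move=> /delayP [sm _].
have half O1 G1 : sub_moves p O1 G1 -> legal_run (tog b N p A) O1 ->
    legal_run (tog b N p A) G1 -> forall s, initial s (pmap_fi (switch_index N) O1) ->
    exists2 t, initial t (pmap_fi (switch_index N) G1) & pre s t.
  move=> sub lO lG _ /initial_pmap_fi [n ->].
  have [_ [m ->] h] := sub _ (initial_upto n O1).
  exists (pmap (switch_index N) (upto m G1)); first by apply/initial_pmap_fi; exists m.
  have [wfO _ _] := lO _ (initial_upto n O1); have [wfG _ _] := lG _ (initial_upto m G1).
  by rewrite (switches_mv wfO) (switches_mv wfG); exact: pre_pmap.
by move=> lO lG; have [h1 h2] := sm p; apply: fiseq_ext; apply: half.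
Qed.

Lemma tog_static b N p A : in_range N 1 ->
  (forall i, in_range N i -> cstatic (A i)) -> cstatic (tog b N p A).
Proof.
move=> r1 st.
have Q : lag_legal (tog b N p A).
  by apply: tog_lag_legal => i ri; apply/static_lag_legal/st.
have switcher O G : delay p O G -> legal_run (tog b N p A) O ->
    legal_run (tog b N p A) G -> tog_winner N p A G = p -> tog_winner N p A O = p.
  move=> dl lO lG; rewrite /tog_winner; case: asboolP; last by case: (p).
  move=> [l [el wl]] _; rewrite asboolT //; exists l; split.
    by rewrite (switches_delay dl lO lG).
  apply: st (delay_proj _ dl) wl.
  (* The switches all lie in a finite segment, so the active component is in range; with no switch
     this is [r1]. *)
  have [n ->] : exists n, l = pmap (switch_index N) (upto n G).
    by apply/initial_pmap_fi; rewrite el; apply/initial_Fin/pre_refl.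
  exact: last_switch_range.
move=> q G O dl [[lG wG]|il]; last first.
  by right; apply: lag_legal_delay il => //; exact: delay_sym.
have [lO|[r ilr]] := legal_or_illegal (tog b N p A) O; last first.
  have [er|er] : r = q \/ r = ~~ q by case: (r) (q) => -[]; auto.
    by rewrite er in ilr; case: (illegal_not_legal (lag_legal_delay Q dl ilr)).
  by right; rewrite -er.
left; split=> //; rewrite /= in wG *.
have [eq|ne] := eqVneq q p; first by rewrite eq in dl wG *; exact: switcher wG.
have eq : q = ~~ p by case: (q) (p) ne => -[].
rewrite eq in dl wG *; move: (delay_sym dl); rewrite negbK => dl'.
(* If [p] won [O], then [p] would also win [G], which is a [p]-delay of [O]. *)
apply: contrapT => nw; move: wG; rewrite (switcher _ _ dl' lG lO); first by case: (p).
by case: (tog_winner N p A O) nw; case: (p).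
Qed.

Theorem theorem3p2 (Var Const : Type) :
  (forall (n : nat) (A : nat -> game Var Const),
     2 <= n ->
     (forall i, 1 <= i <= n -> static (A i)) ->
     [/\ static (tog_disj n A), static (tog_conj n A),
         static (seq_disj n A) & static (seq_conj n A)]) /\
  (forall A : nat -> game Var Const,
     (forall i, 1 <= i -> static (A i)) ->
     [/\ static (tog_disj_inf A), static (tog_conj_inf A),
         static (seq_disj_inf A) & static (seq_conj_inf A)]).
Proof.
split=> [n A n2 st|A st].
  by split=> e; apply: tog_static => [|i ri]; rewrite /in_range ?(ltnW n2) //; exact: st.
by split=> e; apply: tog_static => // i /andP[i1 _]; exact: st.
Qed.
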